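(* Let $X$ be a finite set of $n$ points in the plane such that no two distinct points of $X$ share their $x$-coordinate and no two distinct points of $X$ share their $y$-coordinate, and let $d$ be the $L_1$ metric restricted to $X$, i.e. $d((u_1,u_2),(v_1,v_2))=|u_1-v_1|+|u_2-v_2|$. Then in the metric space $(X,d)$ either there is a line that contains all points of $X$, or there are at least $n$ distinct lines.
   Context: In a metric space $(V,\rho)$, a point $x$ is between $a$ and $b$, written $[axb]$, if $\rho(a,b)=\rho(a,x)+\rho(x,b)$. For distinct $a,b\in V$, the line determined by $a$ and $b$ is $\langle a,b\rangle=\{x\in V:[xab]\}\cup\{a\}\cup\{x\in V:[axb]\}\cup\{b\}\cup\{x\in V:[abx]\}$. Lines are compared as subsets of $V$; ''distinct lines'' means distinct sets of this form.
   Formalization: The case n = 1 is excluded: a single point determines no line, so there is neither a line containing all points nor at least one line, and the claim as worded fails there. *)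

(* Defs.v *)
From HB Require Import structures.
From mathcomp Require Import all_boot all_order all_algebra.
From mathcomp Require Import finmap reals.

Set Implicit Arguments.
Unset Strict Implicit.
Unset Printing Implicit Defensive.

Import Order.TTheory GRing.Theory Num.Theory.
Local Open Scope ring_scope.

Section Lines.
Variables (R : realType) (V : finType) (rho : V -> V -> R).

(* [a x b]: the middle argument is the point in between. *)
Definition between (a x b : V) : bool := rho a b == rho a x + rho x b.

Definition line (a b : V) : {set V} :=
  [set x | between x a b] :|: [set a] :|: [set x | between a x b]
    :|: [set b] :|: [set x | between a b x].

Definition lines : {set {set V}} :=
  [set line a b | a in V, b in V & a != b].

End Lines.

Definition l1_dist (R : realType) (u v : R * R) : R :=
  `|u.1 - v.1| + `|u.2 - v.2|.

(* A finite set X of points coerces to the finite type of its elements. *)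
Definition l1_on (R : realType) (X : {fset R * R}) (u v : X) : R :=
  l1_dist (val u) (val v).

(* Main.v *)
Require Import Defs.
From HB Require Import structures.
From mathcomp Require Import all_boot all_order all_algebra.
From mathcomp Require Import finmap reals.
From mathcomp Require Import lra.

Set Implicit Arguments.
Unset Strict Implicit.
Unset Printing Implicit Defensive.

Import Order.TTheory GRing.Theory Num.Theory.
Local Open Scope ring_scope.

(* Colour a pair of points by whether it is comparable in the dominance order of
   the plane. The line of [a] and [b] then consists of [a], [b] and the points
   [z] such that the triangle [a b z] is monochromatic, so only a two-colouring
   of pairs matters. Induct on the point set [S], without universal line: it
   suffices to find a point [x] such that [S :\ x] has no universal line and
   some line through [x] is not generated by two points other than [x].
   - If some [S :\ x] has a universal line [u v], then [u] and [v] are joined to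
     (almost) everything in one colour, and [u] or [v] can be deleted.
   - Otherwise suppose every line through [x] is generated off [x], for all [x].
     A maximal line [L] of comparable points is then generated by every pair of
     a three-point chain. A point off [L] is comparable to at most one point of
     the chain, hence not to its middle point [b], since being comparable to [b]
     entails being comparable to an end. For [y] off [L] choose an end [a] of
     the chain incomparable to [y]; generators [p], [q] other than [a] of the
     line of [a] and [y] lie off [L], so they are incomparable to [b], which
     puts [b] on that line although [b] is comparable to [a]. *)

(** * Lines of a two-coloured point set *)

Section MonochromaticLines.
Variables (T : finType) (lt : rel T).
Hypothesis lt_trans : transitive lt.
Implicit Types (D S : {set T}) (a b c p q u v x y z : T).

Definition comparable x y := lt x y || lt y x.
Local Notation col := comparable.

Lemma comparableC : symmetric col.
Proof. by move=> x y; rewrite /col orbC. Qed.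

Definition mono a b : {set T} :=
  [set z | [|| z == a, z == b | (col z a == col a b) && (col z b == col a b)]].

(** Generators come from [D], points from [S]: this lets lines of [S] generated off a given point be
    counted. *)
Definition mono_lines D S : {set {set T}} :=
  [set S :&: mono a b | a in D, b in D & a != b].

Definition universal S :=
  [exists a in S, exists b in S, (a != b) && (S \subset mono a b)].

Lemma universalP S :
  reflect (exists a b, [/\ a \in S, b \in S, a != b & S \subset mono a b])
          (universal S).
Proof.
apply: (iffP existsP) => [[a /andP[aS /existsP[b /and3P[bS ab Sab]]]]|].
  by exists a, b.
case=> a [b [aS bS ab Sab]]; exists a; rewrite aS; apply/existsP; exists b.
by rewrite bS ab.
Qed.

Lemma monoC a b : mono a b = mono b a.
Proof.
apply/setP=> z; rewrite !inE (comparableC b a) (andbC (col z b == _)).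
by rewrite orbCA.
Qed.

Lemma mono_l a b : a \in mono a b. Proof. by rewrite inE eqxx. Qed.
Lemma mono_r a b : b \in mono a b. Proof. by rewrite inE eqxx orbT. Qed.

Lemma in_mono z a b : z != a -> z != b ->
  (z \in mono a b) = (col z a == col a b) && (col z b == col a b).
Proof. by rewrite inE => /negPf-> /negPf->. Qed.

Lemma monoP z a b : z \in mono a b -> z != a -> z != b ->
  col z a = col a b /\ col z b = col a b.
Proof. by move=> + za zb; rewrite in_mono// => /andP[/eqP ? /eqP ?]. Qed.

Lemma mono_linesP D S (L : {set T}) :
  reflect (exists a b, [/\ a \in D, b \in D, a != b & L = S :&: mono a b])
          (L \in mono_lines D S).
Proof.
apply: (iffP imset2P) => [[a b aD]|[a [b [aD bD ab ->]]]].
  by rewrite inE => /andP[bD ab] ->; exists a, b.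
by exists a b; rewrite // inE bD.
Qed.

Definition star_at S x v := S :&: mono x v \notin mono_lines (S :\ x) S.

(** Removing [x] from the lines of [S] generated off [x] yields every line of [S :\ x], and the line
    of [x] and [v] is an extra one. *)
Lemma card_mono_lines_star S x v : x \in S -> v \in S -> x != v ->
  star_at S x v -> (#|mono_lines (S :\ x) (S :\ x)| < #|mono_lines S S|)%N.
Proof.
move=> xS vS xv star; pose E := mono_lines (S :\ x) S.
have sub : mono_lines (S :\ x) (S :\ x) \subset [set L :\ x | L in E].
  apply/subsetP=> L /mono_linesP[p [q [pS qS pq ->]]]; apply/imsetP.
  exists (S :&: mono p q); last by rewrite setIDAC.
  by apply/mono_linesP; exists p, q.
apply: leq_ltn_trans (subset_leq_card sub) _.
apply: leq_ltn_trans (leq_imset_card _ _) _; apply: proper_card.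
apply/properP; split.
  apply/subsetP=> L /mono_linesP[p [q [/setD1P[_ pS] /setD1P[_ qS] pq ->]]].
  by apply/mono_linesP; exists p, q.
by exists (S :&: mono x v) => //; apply/mono_linesP; exists x, v.
Qed.

(** * Deleting [u] or [v] when they generate a universal line of [S :\ x] *)

Section Dominated.
Variables (S : {set T}) (x u v : T) (c : bool).
Hypotheses (xS : x \in S) (uS : u \in S) (vS : v \in S).
Hypotheses (xu : x != u) (xv : x != v) (uv : u != v).
Hypothesis cuv : col u v = c.
Hypothesis domu : forall z, z \in S -> z != x -> z != u -> col z u = c.
Hypothesis domv : forall z, z \in S -> z != x -> z != v -> col z v = c.
Hypothesis cxv : col x v != c.

(** Every point but [x] is joined to [v] in colour [c], and [x] is not, so the line of [v] and [x]
    is just this pair. *)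
Lemma dominated_star : star_at S v x.
Proof.
apply/mono_linesP=> -[p [q [/setD1P[pv pS] /setD1P[qv qS] pq /esym E]]].
have gen r : r \in S -> r != v -> r \in mono p q -> r = x.
  move=> rS rv rpq; have : r \in S :&: mono p q by rewrite inE rS.
  rewrite E inE rS /=; case: (eqVneq r x) => // rx rm.
  have [] := monoP rm rv rx; rewrite domv// (comparableC v x) => /esym/eqP.
  by rewrite (negPf cxv).
have px := gen p pS pv (mono_l p q); have qx := gen q qS qv (mono_r p q).
by rewrite px qx eqxx in pq.
Qed.

(** Neither [x] nor [v] can generate a universal line [r s] of [S :\ u]. As it contains [v], it has
    colour [c]; then it contains [u] as well and is universal in [S]. *)
Lemma dominated_delete : ~~ universal S -> (3 < #|S|)%N ->
  ~~ universal (S :\ u).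
Proof.
move=> nuS S4.
(* The line of [x] and [v] misses this fourth point; with three points it would be universal in
   [S :\ u]. *)
have [t tS] : exists2 t, t \in S & t \notin x |: (u |: [set v]).
  apply/subsetPn/negP => /subset_leq_card; apply/negP; rewrite -ltnNge.
  apply: leq_ltn_trans S4; rewrite !cardsU1 cards1.
  exact: (leq_add (leq_b1 _) (leq_add (leq_b1 _) (leqnn 1))).
rewrite !inE !negb_or => /and3P[tx tu tv].
apply/negP => /universalP[r [s [rS sS rs /subsetP H]]].
have noxv r' s' : r' \in S -> s' \in S -> r' != u -> s' != u -> r' != s' ->
    {in S :\ u, forall z, z \in mono r' s'} -> (r' != x) && (r' != v).
  move=> {r s rS sS rs H} {}rS {}sS ru su rs H.
  apply/andP; split; apply/eqP => E; subst r'.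
    have [E|sv] := eqVneq s' v.
      subst s'; have /monoP : t \in mono x v by apply: H; rewrite !inE tu.
      by case=> // _; rewrite domv// => /esym/eqP; rewrite (negPf cxv).
    have /monoP : v \in mono x s' by apply: H; rewrite !inE eq_sym uv.
    case; rewrite // 1?eq_sym// comparableC => <-.
    rewrite comparableC domv// 1?eq_sym// => /esym/eqP.
    by rewrite (negPf cxv).
  have [E|sx] := eqVneq s' x.
    subst s'; have /monoP : t \in mono v x by apply: H; rewrite !inE tu.
    case=> //; rewrite domv// comparableC => /esym/eqP.
    by rewrite (negPf cxv).
  have /monoP : x \in mono v s' by apply: H; rewrite !inE xu.
  case; rewrite // 1?eq_sym// => + _.
  rewrite [col v _]comparableC (domv sS)// 1?eq_sym//.
  by move=> /eqP; rewrite (negPf cxv).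
have [/setD1P[ru {}rS] /setD1P[su {}sS]] := (rS, sS).
have /andP[rx rv] : (r != x) && (r != v) by apply: (noxv r s).
have /andP[sx sv] : (s != x) && (s != v).
  by apply: (noxv s r); rewrite // 1?eq_sym// => z; rewrite monoC; exact: H.
have /monoP : v \in mono r s by apply: H; rewrite !inE eq_sym uv.
rewrite ![v == _]eq_sym rv sv comparableC domv// => -[]// crs _.
case/negP: nuS; apply/universalP; exists r, s; split=> //.
apply/subsetP=> z zS; have [->|zu] := eqVneq z u; last first.
  by apply: H; rewrite !inE zu.
by rewrite in_mono// 1?eq_sym// -crs ![col u _]comparableC !domu ?eqxx.
Qed.

Lemma dominating_star : ~~ universal S -> col x u = c ->
  universal (S :\ v) -> star_at S u x.
Proof.
move=> nuS cxu /universalP[p [q [pS qS pq /subsetP H]]].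
have domu' z : z \in S -> z != u -> col z u = c.
  by move=> zS zu; case: (eqVneq z x) => [->//|zx]; exact: domu.
move: pS qS; rewrite !inE => /andP[pv pS] /andP[qv qS].
have cpq : col p q = c.
  have [E|pu] := eqVneq p u.
    by subst p; rewrite comparableC domu'// 1?eq_sym.
  have [E|qu] := eqVneq q u.
    by subst q; rewrite domu'.
  have /monoP : u \in mono p q by apply: H; rewrite !inE uv.
  by case; rewrite // 1?eq_sym// => <- _; rewrite comparableC domu'.
(* Otherwise [v] is joined to [p] and [q] in colour [c], and their line is universal in [S]. *)
have xpq : (p == x) || (q == x).
  apply/negPn/negP; rewrite negb_or => /andP[px qx]; case/negP: nuS.
  apply/universalP; exists p, q; split=> //; apply/subsetP=> z zS.
  have [->|zv] := eqVneq z v; last by apply: H; rewrite !inE zv.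
  by rewrite in_mono// 1?eq_sym// cpq ![col v _]comparableC !domv ?eqxx.
have domx z : z \in S -> z != x -> z != v -> col z x = c.
  move=> zS zx zv; have zpq : z \in mono p q by apply: H; rewrite !inE zv.
  case/orP: xpq => /eqP E; subst x.
    case: (eqVneq z q) => [->|zq]; first by rewrite comparableC.
    by have [->] := monoP zpq zx zq.
  case: (eqVneq z p) => [->//|zp].
  by have [_ ->] := monoP zpq zp zx.
clear p q pq H pv pS qv qS cpq xpq.
have vNux : v \notin mono u x.
  rewrite in_mono// 1?eq_sym// [col u x]comparableC cxu [col v x]comparableC.
  by rewrite (negPf cxv) andbF.
(* If [x] and [s] generated the line, all other points would be joined to [s] in colour [c], making
   the line of [u] and [s] universal. *)
have main r s : r \in S -> s \in S -> r != u -> s != u -> r != s ->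
    S :&: mono r s = S :&: mono u x -> r != x.
  move=> rS sS ru su rs E; apply/eqP => rx; subst r.
  have sv : s != v.
    apply: contraNneq vNux => <-.
    have : s \in S :&: mono x s by rewrite inE sS mono_r.
    by rewrite E inE sS.
  case/negP: nuS; apply/universalP; exists u, s; split=> //.
    by rewrite eq_sym.
  apply/subsetP=> z zS; have [->|zu] := eqVneq z u; first exact: mono_l.
  have [->|zs] := eqVneq z s; first exact: mono_r.
  rewrite in_mono// [col u s]comparableC !domu'// eqxx/=.
  have [->|zx] := eqVneq z x; first by rewrite comparableC domx// 1?eq_sym.
  have [E'|zv] := eqVneq z v.
    by subst z; rewrite comparableC domv// eq_sym.
  have : z \in S :&: mono u x.
    by rewrite inE zS in_mono// [col u x]comparableC cxu domu'// domx// eqxx.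
  rewrite -E inE => /andP[_ /monoP[]]// _ ->.
  by rewrite comparableC domx// 1?eq_sym.
apply/mono_linesP=> -[p [q [/setD1P[pu pS] /setD1P[qu qS] pq /esym E]]].
have px := main p q pS qS pu qu pq E.
have qx : q != x.
  by apply: (main q p); rewrite // 1?eq_sym// monoC.
have notv r : r \in S -> r \in mono p q -> r != v.
  move=> rS rpq; apply: contraNneq vNux => <-.
  have : r \in S :&: mono p q by rewrite inE rS.
  by rewrite E inE rS.
have pv := notv p pS (mono_l _ _); have qv := notv q qS (mono_r _ _).
(* Containing [u] gives the line of [p] and [q] the colour [c], which forces [v] onto it; yet [v] is
   off the line of [u] and [x]. *)
have : u \in S :&: mono p q by rewrite E inE uS mono_l.
rewrite inE => /andP[_ /monoP[]]; rewrite // 1?eq_sym// comparableC.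
rewrite domu// => cpq _.
have : v \in mono p q.
  by rewrite in_mono// 1?eq_sym// -cpq ![col v _]comparableC !domv ?eqxx.
by move=> vpq; have := notv v vS vpq; rewrite eqxx.
Qed.

End Dominated.

(** When [x v] differs in colour from [u v], the point to delete is [u], unless [x u] has the colour
    of [u v] and [S :\ v] has no universal line; then it is [v]. *)
Lemma star_of_universal_delete S x : ~~ universal S -> (3 < #|S|)%N ->
  x \in S -> universal (S :\ x) ->
  exists y z,
    [/\ y \in S, z \in S, y != z, ~~ universal (S :\ y) & star_at S y z].
Proof.
move=> nuS S4 xS /universalP[u [v [uS vS uv /subsetP H]]].
move: uS vS; rewrite !inE => /andP[ux uS] /andP[vx vS].
have domu z : z \in S -> z != x -> z != u -> col z u = col u v.
  move=> zS zx zu; have [->|zv] := eqVneq z v; first by rewrite comparableC.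
  by have /monoP[]// : z \in mono u v by apply: H; rewrite !inE zx.
have domv z : z \in S -> z != x -> z != v -> col z v = col u v.
  move=> zS zx zv; have [->//|zu] := eqVneq z u.
  by have /monoP[]// : z \in mono u v by apply: H; rewrite !inE zx.
(* The point [x] is off the line of [u] and [v], so the colour changes at one of them. *)
wlog cxv : u v uv {H} ux uS vx vS domu domv / col x v != col u v.
  move=> W; have [E1|] := eqVneq (col x v) (col u v); last exact: (W u v).
  have [E2|] := eqVneq (col x u) (col u v); last first.
    by rewrite (comparableC u v) => ?; apply: (W v u);
       rewrite // 1?eq_sym// (comparableC v u).
  case/negP: nuS; apply/universalP; exists u, v; split=> //.
  apply/subsetP=> z zS; have [->|zx] := eqVneq z x.
    by rewrite in_mono// 1?eq_sym// E1 E2 eqxx.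
  by apply: H; rewrite !inE zx.
have xu : x != u by rewrite eq_sym.
have xv : x != v by rewrite eq_sym.
have ndu : ~~ universal (S :\ u).
  by apply: (@dominated_delete S x u v (col u v)).
have [cxu|cxu] := eqVneq (col x u) (col u v).
  have [uSv|nuSv] := boolP (universal (S :\ v)).
    exists u, x; split=> //.
    by apply: (@dominating_star S x u v (col u v)).
  exists v, x; split=> //.
  by apply: (@dominated_star S x v (col u v)).
exists u, x; split=> //.
by apply: (@dominated_star S x u (col u v)).
Qed.

(** * Maximal lines of comparable points *)

(** A point above the middle of a chain is above its bottom, and one below the middle is below its
    top. *)
Lemma middle a b c : col a b -> col b c -> col a c ->
  [\/ forall z, col z a -> col z b || col z c,
      forall z, col z b -> col z a || col z c
    | forall z, col z c -> col z a || col z b].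
Proof.
have mid p q r : lt p q -> lt q r -> forall z, col z q -> col z p || col z r.
  move=> pq qr z /orP[zq|qz].
    by rewrite [col z r]/col (lt_trans zq qr) orbT.
  by rewrite [col z p]/col (lt_trans pq qz) orbT.
have mid' p q r : lt p q -> lt q r ->
    forall z, col z q -> col z r || col z p.
  by move=> pq qr z zq; rewrite orbC (mid p q r).
move=> /orP[ab|ba] /orP[bc|cb] /orP[ac|ca].
- by constructor 2; exact: mid.
- by constructor 2; exact: mid.
- by constructor 3; exact: mid.
- by constructor 1; exact: mid'.
- by constructor 1; exact: mid.
- by constructor 3; exact: mid'.
- by constructor 2; exact: mid'.
- by constructor 2; exact: mid'.
Qed.

Lemma universal_no_star S : (1 < #|S|)%N ->
  (forall x v, x \in S -> v \in S -> x != v -> ~~ star_at S x v) -> universal S.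
Proof.
move=> S1 nostar; apply: contraT => nuS.
have {}nostar x v : x \in S -> v \in S -> x != v ->
    exists p q, [/\ p \in S :\ x, q \in S :\ x, p != q &
                    S :&: mono x v = S :&: mono p q].
  move=> xS vS xv; apply/mono_linesP.
  by have := nostar x v xS vS xv; rewrite negbK.
pose P (i : T * T) := [&& i.1 \in S, i.2 \in S, i.1 != i.2 & col i.1 i.2].
have [[x0 v0] P0|noP] := pickP P; last first.
  (* Without comparable pairs there is one colour, so any two points generate a universal line. *)
  have /card_gt1P[a [b [aS bS ab]]] := S1.
  have nocol z w : z \in S -> w \in S -> z != w -> col z w = false.
    by move=> zS wS zw; have := noP (z, w); rewrite /P /= zS wS zw.
  case/negP: nuS; apply/universalP; exists a, b; split=> //.
  apply/subsetP=> z zS; rewrite inE; have [//|za] := eqVneq z a.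
  by have [//|zb] := eqVneq z b; rewrite !nocol.
case: (@arg_maxnP _ (x0, v0) P (fun i => #|S :&: mono i.1 i.2|)) => //.
case=> x v /and4P[/= xS vS xv cxv] maxL; pose L := S :&: mono x v.
pose adj a := a \in L /\ forall z, z \in L -> z != a -> col z a.
(* The line of [a] and [b] would contain [L] and [y], against the maximality of [L]. *)
have far a b y : adj a -> adj b -> a != b -> y \in S -> y \notin L ->
    col y a -> col y b -> False.
  move=> [aL adja] [bL adjb] ab yS yL ya yb.
  have cab : col a b by apply: adjb.
  have aS : a \in S by case/setIP: aL.
  have bS : b \in S by case/setIP: bL.
  have yab : y \in mono a b by rewrite inE ya yb cab !orbT.
  suff sL : L \proper S :&: mono a b.
    have := maxL (a, b); rewrite /P /= aS bS ab cab => /(_ isT).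
    by rewrite leqNgt proper_card.
  apply/properP; split; last by exists y => //; rewrite inE yS.
  apply/subsetP=> z zL; have /setIP[zS _] := zL; rewrite 2!inE zS /=.
  have [//|za] := eqVneq z a; have [//|zb] := eqVneq z b.
  by rewrite cab adja// adjb//.
have nomiddle a b c : adj a -> adj b -> adj c -> a != b -> b != c -> a != c ->
    (forall z, col z b -> col z a || col z c) -> False.
  move=> adja adjb adjc ab bc ac mid.
  have midL p : p \in S -> p \notin L -> ~~ col p b.
    move=> pS pL; apply/negP => pb; case/orP: (mid p pb) => [pa|pc].
      exact: (far a b p).
    exact: (far b c p).
  have [y yS yL] : exists2 y, y \in S & y \notin L.
    have : ~~ (S \subset mono x v).
      by apply: contra nuS => sub; apply/universalP; exists x, v.
    by case/subsetPn=> y yS yxv; exists y; rewrite // inE yS.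
  wlog ya : a c adja adjc ab bc ac mid / ~~ col y a.
    move=> W; have [ya|] := boolP (col y a); last exact: (W a c).
    apply: (W c a); rewrite // 1?eq_sym//; first by move=> z /mid; rewrite orbC.
    by apply/negP => yc; exact: (far a c y).
  have [[aL adjaL] [bL _]] := (adja, adjb).
  have aS : a \in S by case/setIP: aL.
  have bS : b \in S by case/setIP: bL.
  have nay : a != y by apply: contraNneq yL => <-.
  have nby : b != y by apply: contraNneq yL => <-.
  have cay : col a y = false by rewrite comparableC; apply: negbTE.
  have [p [q [/setD1P[pa pS] /setD1P[qa qS] pq E]]] := nostar a y aS yS nay.
  (* Points other than [a] on the line of [a] and [y] are incomparable to [a], whereas the rest of
     [L] is comparable to [a]. *)
  have off r : r \in S -> r != a -> r \in mono p q ->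
      [/\ r \notin L & col r a = false].
    move=> rS ra rpq; have : r \in S :&: mono a y by rewrite E inE rS.
    rewrite inE rS => ray.
    have cra : col r a = false.
      have [->|ry] := eqVneq r y; first exact: negbTE.
      by have [-> _] := monoP ray ra ry.
    by split=> //; apply/negP => rL; rewrite adjaL in cra.
  have [pL cpa] := off p pS pa (mono_l p q).
  have [qL cqa] := off q qS qa (mono_r p q).
  have apq : a \in mono p q.
    have : a \in S :&: mono a y by rewrite inE aS mono_l.
    by rewrite E => /setIP[].
  have [] := monoP apq; rewrite // 1?eq_sym// comparableC cpa => cpq _.
  have : b \in mono p q.
    rewrite in_mono; last by apply: contraNneq qL => <-.
      by rewrite -cpq ![col b _]comparableC !(negbTE (midL _ _ _)).
    by apply: contraNneq pL => <-.
  move=> bpq; have [] := off b bS _ bpq; first by rewrite eq_sym.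
  by rewrite bL.
(* [L] itself is generated off [x]; a generator [p] other than [x] and [v] completes the chain of
   three points. *)
have [p [q [/setD1P[px pS] /setD1P[qx qS] pq E]]] := nostar x v xS vS xv.
wlog pv : p q pS px qS qx pq E / p != v.
  move=> W; have [pv|] := eqVneq p v; last exact: (W p q).
  have qp : q != p by rewrite eq_sym.
  by apply: (W q p); rewrite ?[mono q p]monoC // -pv.
have pL : p \in L by rewrite /L E inE pS mono_l.
have [cpx cpv] : col p x /\ col p v.
  by have /setIP[_ pxv] := pL; have [-> ->] := monoP pxv px pv.
have xL : x \in L by rewrite inE xS mono_l.
have vL : v \in L by rewrite inE vS mono_r.
have cpq : col p q.
  have : x \in S :&: mono p q by rewrite -E.
  by case/setIP=> _ /monoP[]; rewrite // 1?eq_sym// comparableC cpx.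
have adjx : adj x.
  split=> // z /setIP[_ zxv] zx; have [->|zv] := eqVneq z v.
    by rewrite comparableC.
  by have [->] := monoP zxv zx zv.
have adjv : adj v.
  split=> // z /setIP[_ zxv] zv; have [->//|zx] := eqVneq z x.
  by have [_ ->] := monoP zxv zx zv.
have adjp : adj p.
  split=> // z; rewrite /L E => /setIP[_ zpq] zp; have [->|zq] := eqVneq z q.
    by rewrite comparableC.
  by have [->] := monoP zpq zp zq.
have xp : x != p by rewrite eq_sym.
have vp : v != p by rewrite eq_sym.
have vx : v != x by rewrite eq_sym.
have [] := @middle x v p cxv; rewrite 1?comparableC// => mid.
- by case: (nomiddle v x p).
- by case: (nomiddle x v p).
- by case: (nomiddle x p v).
Qed.

(** * Induction on the point set *)

(** Two points always have a universal line. With three points and none, every pair [S :\ x] is a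
    line. *)
Lemma mono_lines_small S : (1 < #|S| <= 3)%N -> ~~ universal S ->
  (#|S| <= #|mono_lines S S|)%N.
Proof.
move=> S123 nuS.
have S3 : #|S| = 3%N.
  apply/eqP; move: S123; rewrite leq_eqVlt => /andP[/orP[|S2 S3]]; last first.
    by rewrite eqn_leq S3.
  rewrite eq_sym => /cards2P[a [b [ab E]]] _.
  case/negP: nuS; apply/universalP; exists a, b.
  rewrite E !inE !eqxx orbT; split=> //; apply/subsetP=> z; rewrite !inE orbA.
  by move->.
have <- : #|[set S :\ x | x in S]| = #|S|.
  apply: card_in_imset => x y xS yS E; apply/eqP/negPn/negP => xy.
  by have := setD11 x S; rewrite E !inE xy xS.
apply/subset_leq_card/subsetP=> _ /imsetP[x xS ->].
have : #|S :\ x| == 2%N by have := cardsD1 x S; rewrite S3 xS add1n => -[<-].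
case/cards2P=> a [b [ab E]].
have /setD1P[ax aS] : a \in S :\ x by rewrite E !inE eqxx.
have /setD1P[bx bS] : b \in S :\ x by rewrite E !inE eqxx orbT.
apply/mono_linesP; exists a, b; split=> //; apply/setP=> z; rewrite in_setI.
have inD w : w \in S -> w != x -> w \in mono a b.
  move=> wS wx; have : w \in S :\ x by rewrite !inE wx.
  by rewrite E !inE orbA => ->.
have xab : x \notin mono a b.
  apply: contra nuS => xab; apply/universalP; exists a, b; split=> //.
  by apply/subsetP=> w wS; have [->//|] := eqVneq w x; exact: inD.
rewrite !inE -/(z \in mono a b); have [->|zx] := eqVneq z x.
  by move: xab; rewrite inE => /negbTE->; rewrite andbF.
by have [zS|//] := boolP (z \in S); have := inD z zS zx; rewrite inE => ->.
Qed.

Lemma universal_or_many_lines S : (1 < #|S|)%N ->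
  universal S \/ (#|S| <= #|mono_lines S S|)%N.
Proof.
move: {2}#|S| (leqnn #|S|) => k; elim: k S => [|k IH] S; first by case: #|S|.
move=> Sk S1; have [|nuS] := boolP (universal S); [by left | right].
have [S3|S4] := leqP #|S| 3; first by apply: mono_lines_small; rewrite // S1.
have [x [v [xS vS xv nux star]]] : exists x v,
    [/\ x \in S, v \in S, x != v, ~~ universal (S :\ x) & star_at S x v].
  have [/existsP[x /andP[xS]]|] := boolP [exists x in S, universal (S :\ x)].
    exact: star_of_universal_delete.
  rewrite negb_exists => /forallP nud.
  have [|] := boolP [exists x in S, exists v in S, (x != v) && star_at S x v].
    case/existsP=> x /andP[xS /existsP[v /and3P[vS xv star]]].
    by exists x, v; split=> //; have := nud x; rewrite xS.
  rewrite negb_exists => /forallP nostar; case/negP: nuS.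
  apply: universal_no_star => // x v xS vS xv; have := nostar x.
  by rewrite xS negb_exists => /forallP/(_ v); rewrite vS xv.
have Sx : #|S| = #|S :\ x|.+1 by rewrite (cardsD1 x) xS.
rewrite Sx in Sk S4 *; have [||uSx|le] := IH (S :\ x) => //.
- exact: ltnW.
- by rewrite uSx in nux.
- by apply: leq_ltn_trans le _; exact: card_mono_lines_star star.
Qed.

End MonochromaticLines.

(** * Lines of the L1 plane as monochromatic lines *)

(** One-dimensional betweenness: the reverse inequality always holds, so [<=] expresses equality. *)
Lemma normB_tri_eq (R : realDomainType) (p q r : R) : p != q -> q != r ->
  `|p - q| + `|q - r| <= `|p - r| = ((p < q) == (q < r)).
Proof.
move=> /lt_total/orP[] pq /lt_total/orP[] qr;
  rewrite ?pq ?qr ?(lt_gtF pq) ?(lt_gtF qr).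
all: case: (ger0P (p - q)); case: (ger0P (q - r)); case: (ger0P (p - r)) => *.
all: rewrite ?eqxx; by [lra | apply: negbTE; rewrite -ltNge; lra].
Qed.

Section L1Plane.
Variables (R : realType) (X : {fset R * R}).
Hypothesis hx : forall u v, u \in X -> v \in X -> u <> v -> u.1 <> v.1.
Hypothesis hy : forall u v, u \in X -> v \in X -> u <> v -> u.2 <> v.2.
Implicit Types (a b z : X).

Definition dominates a b := ((val a).1 < (val b).1) && ((val a).2 < (val b).2).

Lemma dominates_trans : transitive dominates.
Proof.
move=> b a c /andP[ab1 ab2] /andP[bc1 bc2]; apply/andP.
by split; [exact: lt_trans bc1|exact: lt_trans bc2].
Qed.

Lemma coord1_neq a b : a != b -> (val a).1 != (val b).1.
Proof.
by move/eqP=> ab; apply/eqP/(hx (fsvalP a) (fsvalP b)) => /val_inj.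
Qed.

Lemma coord2_neq a b : a != b -> (val a).2 != (val b).2.
Proof.
by move/eqP=> ab; apply/eqP/(hy (fsvalP a) (fsvalP b)) => /val_inj.
Qed.

Lemma comparable_dominates a b : a != b ->
  comparable dominates a b =
  (((val a).1 < (val b).1) == ((val a).2 < (val b).2)).
Proof.
move=> ab; have := (coord1_neq ab, coord2_neq ab).
rewrite /comparable /dominates; case=> /lt_total/orP[] h1 /lt_total/orP[] h2.
all: by rewrite h1 h2 !(lt_gtF h1) !(lt_gtF h2).
Qed.

(** Each coordinate obeys the triangle inequality, so the sum is tight exactly when both are. *)
Lemma between_l1 a z b : a != z -> z != b ->
  between (@l1_on R X) a z b =
  (((val a).1 < (val z).1) == ((val z).1 < (val b).1)) &&
  (((val a).2 < (val z).2) == ((val z).2 < (val b).2)).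
Proof.
move=> az zb.
rewrite -!normB_tri_eq ?coord1_neq ?coord2_neq// /between /l1_on /l1_dist.
have := ler_distD (val z).1 (val a).1 (val b).1.
have := ler_distD (val z).2 (val a).2 (val b).2.
set d1 := `|_ - _|; set d2 := `|_ - _|; set d3 := `|_ - _|.
set e1 := `|_ - _|; set e2 := `|_ - _|; set e3 := `|_ - _| => h1 h2.
apply/eqP/andP => [E|[E1 E2]]; first split; lra.
Qed.

(** Three points have the same middle point in both coordinates exactly when their two coordinate
    orders agree or are opposite, that is, when the triangle has one colour. *)
Lemma line_l1 a b : a != b -> line (@l1_on R X) a b = mono dominates a b.
Proof.
move=> ab; apply/setP=> z; rewrite !inE.
have [->|za] := eqVneq z a; first by rewrite !orbT.
have [->|zb] := eqVneq z b; first by rewrite !orbT.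
have az : a != z by rewrite eq_sym.
have bz : b != z by rewrite eq_sym.
have flip1 (u w : X) : u != w ->
    ((val w).1 < (val u).1) = ~~ ((val u).1 < (val w).1).
  by move/coord1_neq; case: ltgtP.
have flip2 (u w : X) : u != w ->
    ((val w).2 < (val u).2) = ~~ ((val u).2 < (val w).2).
  by move/coord2_neq; case: ltgtP.
rewrite !orbF /= !between_l1// !comparable_dominates//.
rewrite (flip1 z a)// (flip1 z b)// (flip2 z a)// (flip2 z b)//.
(* These four implications exclude the two cyclic patterns in each coordinate; a truth table does
   the rest. *)
have t1 : ((val z).1 < (val a).1) && ((val a).1 < (val b).1) ==>
    ((val z).1 < (val b).1).
  by apply/implyP=> /andP[]; exact: lt_trans.
have s1 : ((val z).1 < (val b).1) && ~~ ((val a).1 < (val b).1) ==>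
    ((val z).1 < (val a).1).
  by rewrite -flip1//; apply/implyP=> /andP[]; exact: lt_trans.
have t2 : ((val z).2 < (val a).2) && ((val a).2 < (val b).2) ==>
    ((val z).2 < (val b).2).
  by apply/implyP=> /andP[]; exact: lt_trans.
have s2 : ((val z).2 < (val b).2) && ~~ ((val a).2 < (val b).2) ==>
    ((val z).2 < (val a).2).
  by rewrite -flip2//; apply/implyP=> /andP[]; exact: lt_trans.
move: t1 t2 s1 s2.
by do 3 case: ((val _).1 < (val _).1); do 3 case: ((val _).2 < (val _).2).
Qed.

Lemma lines_l1 : lines (@l1_on R X) = mono_lines dominates setT setT.
Proof.
apply/setP=> L; apply/imset2P/mono_linesP.
  case=> a b _; rewrite inE => /andP[_ ab] ->; exists a, b.
  by rewrite setTI line_l1.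
case=> a [b [_ _ ab ->]]; exists a b; rewrite ?inE//.
by rewrite setTI line_l1.
Qed.

End L1Plane.

Theorem theorem1 (R : realType) (n : nat) (X : {fset R * R})
    (hn : #|` X|%fset = n) (hn1 : n <> 1%N)
    (hx : forall u v, u \in X -> v \in X -> u <> v -> u.1 <> v.1)
    (hy : forall u v, u \in X -> v \in X -> u <> v -> u.2 <> v.2) :
  (exists2 L, L \in lines (@l1_on R X) & forall x : X, x \in L)
  \/ (n <= #|lines (@l1_on R X)|)%N.
Proof.
have cX : #|[set: X]| = n by rewrite cardsT -cardfE.
(* For [n = 0] the bound is trivial; [hn1] excludes the single point, which has no line. *)
have [n1|n1] := leqP n 1; first by right; case: n n1 {hn cX} hn1 => [|[]].
rewrite lines_l1//; have := universal_or_many_lines (@dominates_trans R X).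
move=> /(_ setT); rewrite cX => -[]//; last by right.
case/universalP=> a [b [_ _ ab /subsetP sub]]; left.
exists (setT :&: mono (@dominates R X) a b).
  by apply/mono_linesP; exists a, b.
by move=> x; rewrite setTI; apply: sub; rewrite inE.
Qed.
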